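(* For any integer $M\ge3$ and any real $a\ne0$, for all but finitely many real numbers $r$, the geometric progression $\{ar^i\mid0\le i\le M-1\}$ of length $M$ has the highest possible complexity, i.e., complexity $M-1$.
   Context: For a finite set $\mathcal{A}\subset\mathbb{R}$, the complexity $C(\mathcal{A})$ is the smallest positive integer $\theta$ for which there exist (not necessarily distinct) real numbers $x_1,\dots,x_\theta,y_1,\dots,y_\theta$ with $\mathcal{A}\subseteq\{x_1,y_1\}+\{x_2,y_2\}+\cdots+\{x_\theta,y_\theta\}$, where $+$ denotes the sumset $\mathcal{S}+\mathcal{T}=\{s+t\mid s\in\mathcal{S},t\in\mathcal{T}\}$. The highest possible complexity of a set of size $M\ge2$ is $M-1$. *)

(* Defs.v *)
From mathcomp Require Import all_boot all_order all_algebra.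
From mathcomp Require Import finmap.
From mathcomp Require Import boolp classical_sets functions cardinality reals.

Set Implicit Arguments.
Unset Strict Implicit.
Unset Printing Implicit Defensive.

Import Order.TTheory GRing.Theory Num.Theory.

Local Open Scope classical_set_scope.
Local Open Scope ring_scope.

Definition sumset (R : realType) (S T : set R) : set R :=
  [set s + t | s in S & t in T].

(* The seed [set 0] is the neutral element of sumset, so for theta > 0 the
   iterated operation is {x_1, y_1} + ... + {x_theta, y_theta}. *)
Definition in_pair_sumset (R : realType) (A : {fset R}) (theta : nat) : Prop :=
  exists x y : 'I_theta -> R,
    [set` A] `<=` \big[@sumset R/[set 0]]_(i < theta) [set x i; y i].

Lemma mem_big_sumset (R : realType) (n : nat) (z : 'I_n -> R)
    (S : 'I_n -> set R) :
  (forall i, S i (z i)) -> (\big[@sumset R/[set 0]]_(i < n) S i) (\sum_i z i).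
Proof.
move=> Sz; apply: (big_ind2 (fun (U : set R) u => U u)) => //.
by move=> U u V v Uu Vv; exists u => //; exists v.
Qed.

Lemma in_pair_sumset_ex (R : realType) (A : {fset R}) :
  exists theta : nat, `[< (0 < theta)%N /\ in_pair_sumset A theta >].
Proof.
exists (size A).+1; apply/asboolP; split=> //.
exists (fun i => A`_i), (fun=> 0) => u /= uA.
have lt_uA : (index u A < (size A).+1)%N by rewrite ltnS index_size.
pose k := Ordinal lt_uA.
have -> : u = \sum_(i < (size A).+1) (if i == k then A`_i else 0).
  by rewrite -big_mkcond big_pred1_eq /= nth_index.
by apply: mem_big_sumset => i; case: ifP => _; [left|right].
Qed.

Definition complexity (R : realType) (A : {fset R}) : nat :=
  ex_minn (in_pair_sumset_ex A).

Definition geometric_progression (R : realType) (M : nat) (a r : R) : {fset R} :=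
  [fset a * r ^+ (i : 'I_M) | i : 'I_M]%fset.

(* Main.v *)
Require Import Defs.
From mathcomp Require Import all_boot all_order all_algebra.
From mathcomp Require Import finmap.
From mathcomp Require Import boolp classical_sets functions cardinality reals.

Import Order.TTheory GRing.Theory Num.Theory.

Local Open Scope classical_set_scope.
Local Open Scope ring_scope.

(** If the progression has complexity at most theta, subtracting the sum of the
    x_i shows that the vector (a r^j)_j lies in the column space of an
    M x (1 + theta) matrix consisting of a column of ones and theta columns
    with entries 0 and 1. When 1 + theta < M, such a matrix has a nonzero
    vector c in its left kernel, so r is a root of the nonzero polynomial
    \sum_j c_j X^j. There are only finitely many such matrices, hence finitely
    many exceptional r. *)

Lemma finite_set_root (R : idomainType) (p : {poly R}) :
  p != 0 -> finite_set [set r | root p r].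
Proof.
move=> p0; apply: contrapT => /(infinite_set_fset (size p))[S Sp leS].
have : (size S < size p)%N.
  apply: max_poly_roots => //; last exact: fset_uniq.
  by apply/allP => r rS; exact: Sp.
by rewrite ltnNge leS.
Qed.

Lemma big_sumsetP {R : realType} {n : nat} {S : 'I_n -> set R} {u : R} :
  (\big[@sumset R/[set 0]]_(i < n) S i) u ->
  exists2 z : 'I_n -> R, (forall i, S i (z i)) & u = \sum_i z i.
Proof.
elim: n S u => [|n IHn] S u.
  by rewrite big_ord0 => ->; exists (fun=> 0); rewrite ?big_ord0 // => -[].
rewrite big_ord_recl => -[s Ss [t /IHn[z Sz ->] <-]].
exists (fun i => if unlift ord0 i is Some j then z j else s) => [i|].
  by case: unliftP => [j|] ->.
rewrite big_ord_recl unlift_none; congr (_ + _).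
by apply: eq_bigr => i _; rewrite liftK.
Qed.

Lemma complexity_le {R : realType} {A : {fset R}} {theta : nat} :
  (0 < theta)%N -> in_pair_sumset A theta -> (complexity A <= theta)%N.
Proof.
move=> theta0 Atheta; rewrite /complexity; case: ex_minnP => m _; apply.
exact/asboolP.
Qed.

Lemma complexityP {R : realType} (A : {fset R}) :
  in_pair_sumset A (complexity A).
Proof. by rewrite /complexity; case: ex_minnP => m /asboolP[]. Qed.

(** This gives the upper bound [M - 1] on the complexity. The [x i] add up to [f ord0], and
    replacing the single summand [x k] by [y k] moves the sum to [f (lift ord0 k)]. *)
Lemma in_pair_sumset_imfset (R : realType) (n : nat) (f : 'I_n.+2 -> R) :
  in_pair_sumset [fset f i | i : 'I_n.+2]%fset n.+1.
Proof.
pose x (i : 'I_n.+1) := if i == ord0 then f ord0 else 0.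
have sumx : \sum_i x i = f ord0 by rewrite -big_mkcond big_pred1_eq.
exists x, (fun i => x i + (f (lift ord0 i) - f ord0)) => u /imfsetP[/= j _ ->].
case: (unliftP ord0 j) => [k|] ->; last first.
  by rewrite -sumx; apply: mem_big_sumset => i; left.
have -> : f (lift ord0 k) =
    \sum_i (x i + if i == k then f (lift ord0 i) - f ord0 else 0).
  by rewrite big_split /= sumx -big_mkcond big_pred1_eq addrC subrK.
by apply: mem_big_sumset => i; case: eqP => _; [right | left; rewrite addr0].
Qed.

(** Taking [E] boolean puts the choice patterns in a finite type, over which a union of finite sets
    stays finite. *)
Definition bool_affine_mx (R : nzRingType) (m n : nat) (E : 'M[bool]_(m, n)) :
    'M[R]_(m, 1 + n) :=
  row_mx (const_mx 1) (map_mx (fun b : bool => b%:R) E).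

Lemma in_pair_sumset_mx {R : realType} {m theta : nat} {f : 'I_m -> R} :
  in_pair_sumset [fset f i | i : 'I_m]%fset theta ->
  exists (E : 'M[bool]_(m, theta)) (w : 'cV[R]_(1 + theta)),
    \col_j f j = bool_affine_mx R m theta E *m w.
Proof.
move=> [x [y sub_xy]].
have /choice[z zP] (j : 'I_m) : exists z : 'I_theta -> R,
    (forall i, [set x i; y i] (z i)) /\ f j = \sum_i z i.
  have /sub_xy/big_sumsetP[z zxy fE] : f j \in [fset f i | i : 'I_m]%fset.
    exact: in_imfset.
  by exists z.
(* Each summand is [x i] plus 0 or 1 times [y i - x i]. If [x i = y i], the entry is 0 and the
   weight vanishes as well. *)
exists (\matrix_(j, i) (z j i != x i)).
exists (col_mx (const_mx (\sum_i x i)) (\col_i (y i - x i))).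
apply/colP => j; rewrite mul_row_col !mxE big_ord1 !mxE mul1r.
rewrite (zP j).2 -big_split /=; apply: eq_bigr => i _; rewrite !mxE.
have [->|zx] := eqVneq (z j i) (x i); first by rewrite mul0r addr0.
rewrite mul1r addrC subrK.
by case: ((zP j).1 i) => // zxi; rewrite zxi eqxx in zx.
Qed.

Lemma ltn_left_kernel {F : fieldType} {m n : nat} (A : 'M[F]_(m, n)) :
  (n < m)%N -> exists2 c : 'rV[F]_m, c != 0 & c *m A = 0.
Proof.
move=> nm; have : kermx A != 0.
  by rewrite -mxrank_eq0 mxrank_ker subn_eq0 -ltnNge (leq_ltn_trans (rank_leq_col A)).
by case/rowV0Pn => c /sub_kermxP cA c0; exists c.
Qed.

Lemma finite_geometric_in_pair_sumset (R : realType) (M theta : nat) (a : R) :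
  a != 0 -> (theta.+1 < M)%N ->
  finite_set [set r | in_pair_sumset (geometric_progression M a r) theta].
Proof.
move=> a0 thetaM.
(* The vector [c E] is fixed before [r] enters, so each pattern [E] yields one polynomial that
   serves for all [r]. *)
have /choice[c cP] (E : 'M[bool]_(M, theta)) :
    exists c : 'rV[R]_M, c != 0 /\ c *m bool_affine_mx R M theta E = 0.
  by have [c c0 cE] := ltn_left_kernel (bool_affine_mx R M theta E) thetaM; exists c.
apply: (@sub_finite_set _ _ (\bigcup_E [set r | root (rVpoly (c E)) r])).
  move=> r /in_pair_sumset_mx[E [w rE]]; exists E => //=.
  have /matrixP/(_ 0 0) : c E *m (\col_(j < M) (a * r ^+ j)) = 0.
    by rewrite rE mulmxA (cP E).2 mul0mx.
  (* The relation obtained is [a] times the value of the polynomial at [r], and [a] is nonzero. *)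
  rewrite !mxE => sum0; rewrite /root -(mulrI_eq0 _ (mulfI a0)) horner_poly.
  apply/eqP; rewrite mulr_sumr -[RHS]sum0; apply: eq_bigr => j _.
  by rewrite valK !mxE mulrCA.
apply: bigcup_finite => [|E _]; first exact: finite_finset.
apply: finite_set_root; apply: contraNneq (cP E).1 => cE0.
by rewrite -[c E]rVpolyK cE0 linear0.
Qed.

Theorem proposition9 (R : realType) (M : nat) (a : R)
    (hM : (3 <= M)%N) (ha : a != 0) :
  finite_set [set r : R |
    complexity (geometric_progression M a r) <> (M - 1)%N].
Proof.
(* Since the complexity is at most [M - 1], an exceptional [r] has complexity strictly below it,
   which leaves finitely many values of [theta]. *)
apply: (@sub_finite_set _ _ (\bigcup_(theta in `I_(M - 1))
    [set r | in_pair_sumset (geometric_progression M a r) theta])).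
  move=> r /eqP cM; exists (complexity (geometric_progression M a r)) => /=; last first.
    exact: complexityP.
  rewrite ltn_neqAle cM /=; apply: complexity_le; first by rewrite subn_gt0 ltnW.
  by case: M hM {cM} => [|[|n]] // _; rewrite subn1; apply: in_pair_sumset_imfset.
apply: bigcup_finite => [|theta /= thetaM]; first exact: finite_II.
by apply: finite_geometric_in_pair_sumset; rewrite // -[theta.+1]add1n -ltn_subRL.
Qed.
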